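(* Let $\rho>0$, let $\{a_i\}_{i\in\mathbb{N}}$ be a sequence of positive numbers with $\sum_{i=1}^\infty a_i=1$, and let $\{z_i\}_{i\in\mathbb{N}}$ be a sequence of distinct complex numbers with $|z_i|<\rho$ for all $i\in\mathbb{N}$ and $\lim_{i\to\infty}z_i=\rho$. Let $f(z)=\sum_{i=1}^\infty\frac{a_i}{z-z_i}$, a meromorphic function in the disk $\mathbb{D}(\rho)=\{z\in\mathbb{C}:|z|<\rho\}$. If $f$ has a non-empty (discrete) set of zeros $\{w_j\}_{j\in\mathbb{N}}$ in $\mathbb{D}(\rho)$, then the inequality $$\sum_{j=1}^\infty\Phi(\lambda w_j+\mu)\le\sum_{i=1}^\infty(1-a_i)\,\Phi(\lambda z_i+\mu)$$ holds for all $\lambda\in\mathbb{C}\setminus\{0\}$, $\mu\in\mathbb{C}$ and any nonnegative convex function $\Phi:\mathbb{C}\to\mathbb{R}$.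
   Context: $\mathbb{C}$ is identified with $\mathbb{R}^2$ when speaking of convex functions. Sums of nonnegative terms take values in $[0,+\infty]$. The zero set is only assumed to be non-empty; if it is finite, the left-hand sum extends over its finitely many elements. *)

(* Defs.v *)
From HB Require Import structures.
From mathcomp Require Import all_boot all_order all_algebra.
From mathcomp Require Import all_classical all_reals all_analysis.
From mathcomp Require Import complex.

Set Implicit Arguments.
Unset Strict Implicit.
Unset Printing Implicit Defensive.

Import Order.TTheory GRing.Theory Num.Theory.
Import numFieldNormedType.Exports.

Local Open Scope classical_set_scope.
Local Open Scope ring_scope.
Local Open Scope complex_scope.

(* The library puts the norm topology of the numFieldType [R[i]] on its alias
   [R[i]^o]; the cast below selects that topology.
   [limn] is a total operator and division by 0 yields 0: the value is the
   intended one when the series converges and [w] is none of the [z i]. *)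
Definition pole_series (R : realType) (a : nat -> R) (z : nat -> R[i])
    (w : R[i]) : R[i] :=
  limn (series (fun i => (a i)%:C / (w - z i)) : nat -> R[i]^o).

(* The points [z i] are poles of the meromorphic function, hence excluded. *)
Definition disk_zeros (R : realType) (rho : R) (a : nat -> R)
    (z : nat -> R[i]) : set R[i] :=
  [set w | [/\ `|w| < rho%:C, forall i, w != z i & pole_series a z w = 0]].

(* Main.v *)
(* In the Hilbert space L^2(a) on the indices, let D be multiplication by z and
   P the projection onto the orthogonal complement of the constants. If w is a
   zero of f, the resolvent g = 1 / (z - w) is orthogonal to 1 and
   D g = w g + 1, so w is an eigenvalue of P D P with eigenvector g.
   Orthogonalizing the eigenvectors of finitely many distinct zeros gives
   orthogonal functions u_w with <D u_w, u_w> = w <u_w, u_w>, that is,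
   w = sum_i p_w(i) z_i with p_w(i) = a_i |u_w(i)|^2 / <u_w, u_w>. Jensen's
   inequality bounds Phi at w by the p_w-average of Phi over the z_i, and
   Bessel's inequality, applied to the u_w together with 1, gives
   sum_w p_w(i) <= 1 - a_i. *)
Require Import Defs.
From HB Require Import structures.
From mathcomp Require Import all_boot all_order all_algebra.
From mathcomp Require Import all_classical all_reals all_analysis.
From mathcomp Require Import complex.
From mathcomp Require Import ring lra.

Set Implicit Arguments.
Unset Strict Implicit.
Unset Printing Implicit Defensive.

Import Order.TTheory GRing.Theory Num.Theory.
Import numFieldNormedType.Exports.

Local Open Scope classical_set_scope.
Local Open Scope ring_scope.
Local Open Scope complex_scope.

Local Notation Re := complex.Re.
Local Notation Im := complex.Im.

(** * Coordinates, convergence and bounded sequences in [R[i]] *)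

Section ComplexFacts.
Variable R : realType.
Implicit Types (x y : R[i]) (u v : nat -> R[i]).

Lemma ReD x y : Re (x + y) = Re x + Re y. Proof. by case: x; case: y. Qed.
Lemma ImD x y : Im (x + y) = Im x + Im y. Proof. by case: x; case: y. Qed.
Lemma ReM x y : Re (x * y) = Re x * Re y - Im x * Im y.
Proof. by case: x; case: y. Qed.
Lemma ImM x y : Im (x * y) = Re x * Im y + Im x * Re y.
Proof. by case: x; case: y. Qed.

Lemma complex_eq x y : Re x = Re y -> Im x = Im y -> x = y.
Proof. by case: x; case: y => ? ? ? ? /= -> ->. Qed.

Lemma normc_le_ReIm x : `|x| <= (`|Re x| + `|Im x|)%:C.
Proof.
rewrite normc_def lecR -[leRHS]ger0_norm ?addr_ge0// -sqrtr_sqr ler_wsqrtr//.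
rewrite sqrrD !real_normK ?num_real// -addrA [X in _ <= _ + X]addrC lerD2l.
by rewrite lerDl mulrn_wge0// mulr_ge0.
Qed.

Lemma normc_ge_Im x : `|Im x|%:C <= `|x|.
Proof.
by rewrite normc_def lecR -sqrtr_sqr ler_wsqrtr// lerDr sqr_ge0.
Qed.

Lemma ler_Re x y : x <= y -> Re x <= Re y.
Proof. by rewrite lecE => /andP[]. Qed.

Lemma cvg_complex u x : Re (u n) @[n --> \oo] --> Re x ->
  Im (u n) @[n --> \oo] --> Im x -> (u : nat -> R[i]^o) @ \oo --> (x : R[i]^o).
Proof.
move=> /cvgrPdist_lt cre /cvgrPdist_lt cim; apply/cvgrPdist_lt => e e0.
(* In the order of [R[i]], [0 < e] forces [e] to be real, so the tolerance can be halved between the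
   two coordinates. *)
have /andP[/eqP ime ree] : (Im e == 0) && (0 < Re e).
  by move: e0; rewrite ltcE eq_sym => /andP[/eqP-> ->]; rewrite eqxx.
have -> : e = (Re e)%:C by apply: complex_eq.
have h0 : 0 < Re e / 2 by rewrite divr_gt0.
near=> n.
rewrite (le_lt_trans (normc_le_ReIm _))// ltcR (splitr (Re e)) ltrD//.
  have -> : Re (x - u n) = Re x - Re (u n) by case: (x); case: (u n).
  by near: n; exact: cre.
have -> : Im (x - u n) = Im x - Im (u n) by case: (x); case: (u n).
by near: n; exact: cim.
Unshelve. all: by end_near. Qed.

(** The class of functions used in place of all of [L^2(a)]: it is closed under products, and all
    weighted series over it converge. *)
Definition bounded_seq u := exists M : R[i], forall i, `|u i| <= M.

Lemma bounded_cst c : bounded_seq (fun=> c).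
Proof. by exists `|c|. Qed.

Lemma boundedD u v : bounded_seq u -> bounded_seq v ->
  bounded_seq (fun i => u i + v i).
Proof.
move=> [M uM] [N vN]; exists (M + N) => i.
by rewrite (le_trans (ler_normD _ _))// lerD.
Qed.

Lemma boundedM u v : bounded_seq u -> bounded_seq v ->
  bounded_seq (fun i => u i * v i).
Proof. by move=> [M uM] [N vN]; exists (M * N) => i; rewrite normrM ler_pM. Qed.

Lemma boundedJ u : bounded_seq u -> bounded_seq (fun i => conjc (u i)).
Proof. by move=> [M uM]; exists M => i; rewrite normcJ. Qed.

Lemma bounded_sum (T : eqType) (s : seq T) (F : T -> nat -> R[i]) :
  (forall t, t \in s -> bounded_seq (F t)) ->
  bounded_seq (fun i => \sum_(t <- s) F t i).
Proof.
elim: s => [|t s ih] bF.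
  by under eq_fun do rewrite big_nil; exact: bounded_cst.
under eq_fun do rewrite big_cons; apply: boundedD.
  by apply: bF; rewrite mem_head.
by apply: ih => t' ?; apply: bF; rewrite inE orbC; apply/orP; left.
Qed.

(* The limit of [w - z i] is nonzero because [z i] tends to a point of modulus
   [rho] while [w] lies inside the disk. *)
Lemma bounded_resolvent (rho : R) (z : nat -> R[i]) w :
  (z : nat -> R[i]^o) @ \oo --> (rho%:C : R[i]^o) -> `|w| < rho%:C ->
  bounded_seq (fun i => (z i - w)^-1).
Proof.
move=> zrho wrho.
have wn : rho%:C - w != 0 :> R[i].
  apply/eqP => /subr0_eq wE; move: wrho; rewrite -wE => wrho.
  have := le_lt_trans (normc_ge_Re _) wrho.
  by rewrite ltcR ltNge ler_norm.
have cv : ((fun i => (z i - w)^-1) : nat -> R[i]^o) @ \oo -->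
    ((rho%:C - w)^-1 : R[i]^o).
  apply: (@cvgV R[i] nat \oo _ (fun i => z i - w) (rho%:C - w) wn).
  move/cvgrPdist_lt: zrho => zrho; apply/cvgrPdist_lt => e /zrho.
  by apply: filterS => i; rewrite opprB addrA subrK.
have /(@cvg_seq_bounded _ R[i]^o) := cvgP _ cv.
case=> M [_ uM].
by exists (M + 1) => i; apply: uM => //; rewrite ltrDl ltr01.
Qed.

End ComplexFacts.

(** * Expectation with respect to the probability weights [a] *)

Section Mean.
Variables (R : realType) (a : nat -> R).
Hypothesis a_gt0 : forall i, 0 < a i.
Hypothesis a_sum1 : series a @ \oo --> (1 : R).
Implicit Types (g h : nat -> R[i]).

(** Taken coordinatewise, so that only real series occur. As [limn] is total, the value is
    meaningful on bounded sequences, by [mean_cvg]. *)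
Definition mean g : R[i] :=
  limn (series (fun i => a i * Re (g i))) +i*
  limn (series (fun i => a i * Im (g i))).

Lemma is_cvg_weighted (f : nat -> R) M : (forall i, `|f i| <= M) ->
  cvgn (series (fun i => a i * f i)).
Proof.
move=> fM; apply: normed_cvg; apply: (@series_le_cvg _ _ (M *: a)).
- by move=> i /=.
- by move=> i; rewrite mulr_ge0 ?(ltW (a_gt0 i))// (le_trans _ (fM 0%N)).
- move=> i /=; rewrite normrM gtr0_norm// mulrC.
  by apply: ler_wpM2r => //; exact: ltW.
- by apply: is_cvg_seriesZ; apply/cvg_ex; exists 1.
Qed.

Lemma mean_cvg g : bounded_seq g ->
  series (fun i => a i * Re (g i)) @ \oo --> Re (mean g) /\
  series (fun i => a i * Im (g i)) @ \oo --> Im (mean g).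
Proof.
move=> [M gM]; split; apply: (@is_cvg_weighted _ (Re M)) => i.
- by have := le_trans (normc_ge_Re (g i)) (gM i); exact: ler_Re.
- by have := le_trans (normc_ge_Im (g i)) (gM i); exact: ler_Re.
Qed.

Lemma mean_unique g l : series (fun i => a i * Re (g i)) @ \oo --> Re l ->
  series (fun i => a i * Im (g i)) @ \oo --> Im l -> mean g = l.
Proof.
move=> gre gim; apply: complex_eq => /=.
  exact: (cvg_lim (@Rhausdorff R) gre).
exact: (cvg_lim (@Rhausdorff R) gim).
Qed.

Lemma mean_lin c g h : bounded_seq g -> bounded_seq h ->
  mean (fun i => c * g i + h i) = c * mean g + mean h.
Proof.
move=> /mean_cvg[g1 g2] /mean_cvg[h1 h2]; apply: mean_unique.
- rewrite ReD ReM.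
  have -> : series (fun i => a i * Re (c * g i + h i)) = fun n =>
      Re c * series (fun i => a i * Re (g i)) n -
      Im c * series (fun i => a i * Im (g i)) n +
      series (fun i => a i * Re (h i)) n.
    apply/funext => n; rewrite /series/= !mulr_sumr -sumrB -big_split/=.
    by apply: eq_bigr => i _; rewrite ReD ReM; ring.
  by apply: cvgD => //; apply: cvgB; apply: cvgMl_tmp.
- rewrite ImD ImM.
  have -> : series (fun i => a i * Im (c * g i + h i)) = fun n =>
      Re c * series (fun i => a i * Im (g i)) n +
      Im c * series (fun i => a i * Re (g i)) n +
      series (fun i => a i * Im (h i)) n.
    apply/funext => n; rewrite /series/= !mulr_sumr -!big_split/=.
    by apply: eq_bigr => i _; rewrite ImD ImM; ring.
  by apply: cvgD => //; apply: cvgD; apply: cvgMl_tmp.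
Qed.

Lemma mean_cst c : mean (fun=> c) = c.
Proof.
have H (x : R) : series (fun i => a i * x) @ \oo --> x.
  have -> : series (fun i => a i * x) = fun n => series a n * x.
    by apply/funext => n; rewrite /series/= mulr_suml.
  by rewrite -[X in _ --> X]mul1r; apply: cvgMr_tmp.
exact: mean_unique.
Qed.

Lemma mean_point i0 c : mean (fun i => if i == i0 then c else 0) = (a i0)%:C * c.
Proof.
have H (f : R[i] -> R) : f 0 = 0 ->
    series (fun i => a i * f (if i == i0 then c else 0)) @ \oo --> a i0 * f c.
  move=> f0; apply: (@cvg_near_cst _ R) => //; near=> n.
  rewrite /series/= (bigD1_seq i0) ?iota_uniq//=; last first.
    rewrite mem_index_iota/=; near: n; exact: nbhs_infty_gt.
  rewrite eqxx big1 ?addr0// => i /negbTE ->.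
  by rewrite f0 mulr0.
by apply: mean_unique; rewrite ?ReM ?ImM/= mul0r ?subr0 ?addr0; exact: H.
Unshelve. all: by end_near. Qed.

Lemma meanZ c g : bounded_seq g -> mean (fun i => c * g i) = c * mean g.
Proof.
move=> bg; rewrite -[RHS]addr0 -[X in _ + X](mean_cst 0) -mean_lin//.
  by congr mean; apply/funext => i; rewrite addr0.
exact: bounded_cst.
Qed.

Lemma meanJ g : bounded_seq g -> mean (fun i => conjc (g i)) = conjc (mean g).
Proof.
move=> /mean_cvg[g1 g2]; apply: mean_unique.
  have -> : (fun i => a i * Re (conjc (g i))) = (fun i => a i * Re (g i)).
    by apply/funext => i; case: (g i).
  by case: (mean g) g1.
have -> : (fun i => a i * Im (conjc (g i))) = - (fun i => a i * Im (g i)).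
  by apply/funext => i; rewrite !fctE; case: (g i) => x y /=; rewrite mulrN.
rewrite seriesN; have -> : Im (conjc (mean g)) = - Im (mean g) by case: (mean g).
exact: cvgN.
Qed.

Lemma mean_sum (T : eqType) (s : seq T) (c : T -> R[i]) (F : T -> nat -> R[i]) :
  (forall t, t \in s -> bounded_seq (F t)) ->
  mean (fun i => \sum_(t <- s) c t * F t i) = \sum_(t <- s) c t * mean (F t).
Proof.
elim: s => [|t s ih] bF.
  by under eq_fun do rewrite big_nil; rewrite mean_cst big_nil.
under eq_fun do rewrite big_cons; rewrite big_cons.
have bs t' : t' \in s -> bounded_seq (F t').
  by move=> ?; apply: bF; rewrite inE orbC; apply/orP; left.
rewrite mean_lin ?ih//; first by apply: bF; rewrite mem_head.
by apply: bounded_sum => t' /bs bt; apply: boundedM => //; exact: bounded_cst.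
Qed.

Lemma mean_ge0 g : bounded_seq g -> (forall i, 0 <= g i) -> 0 <= mean g.
Proof.
move=> /mean_cvg[g1 g2] g0; rewrite lecE.
have g0' i : Re (g i) >= 0 /\ Im (g i) = 0.
  by move: (g0 i); rewrite lecE => /andP[/eqP -> ->].
apply/andP; split.
  have E : series (fun i => a i * Im (g i)) = fun=> 0.
    apply/funext => n; rewrite /series/= big1// => i _.
    by rewrite (g0' i).2 mulr0.
  by apply/eqP; apply: cvg_unique g2 _ => //; rewrite E; exact: cvg_cst.
apply: (ler_cvg_to (cvg_cst 0) g1); near=> n.
by rewrite sumr_ge0// => i _; rewrite mulr_ge0 ?(g0' i).1// ltW.
Unshelve. all: by end_near. Qed.

(** Subtracting from [g] its restriction [d] to the point [i0] leaves a nonnegative function, so the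
    mean is at least [a i0 * g i0]. *)
Lemma mean_gt0 g i0 : bounded_seq g -> (forall i, 0 <= g i) -> g i0 != 0 ->
  0 < mean g.
Proof.
move=> bg g0 gi0; pose d i := if i == i0 then g i0 else 0.
have bd : bounded_seq d.
  by exists `|g i0| => i; rewrite /d; case: ifP => // _; rewrite normr0.
have : 0 <= mean (fun i => (-1) * d i + g i).
  apply: mean_ge0.
    by apply: boundedD => //; apply: boundedM => //; exact: bounded_cst.
  by move=> i; rewrite mulN1r addrC /d; case: eqVneq => [->|_];
    rewrite ?subrr ?subr0.
rewrite mean_lin// mulN1r addrC subr_ge0 mean_point; apply: lt_le_trans.
by rewrite mulr_gt0 ?ltcR// lt_def gi0 g0.
Qed.

(** Turns a zero of the meromorphic function into orthogonality of the resolvent to the constants.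
    The proof also shows that the defining series converges. *)
Lemma pole_series_mean (z : nat -> R[i]) w :
  bounded_seq (fun i => (z i - w)^-1) ->
  pole_series a z w = - mean (fun i => (z i - w)^-1).
Proof.
move=> bz; rewrite -mulN1r -meanZ//.
have /mean_cvg[c1 c2] : bounded_seq (fun i => -1 * (z i - w)^-1).
  by apply: boundedM => //; exact: bounded_cst.
rewrite /pole_series; set m := mean _ in c1 c2 *.
apply: (cvg_lim (@norm_hausdorff R[i] R[i]^o)); apply: cvg_complex.
- have -> // : (fun n => Re (series (fun i => (a i)%:C / (w - z i)) n)) =
    series (fun i => a i * Re (-1 * (z i - w)^-1)).
  apply/funext => n; rewrite /series/= (big_morph _ (@ReD R) (erefl : Re 0 = 0)).
  by apply: eq_bigr => i _; rewrite mulN1r -invrN opprB ReM /= mul0r subr0.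
- have -> // : (fun n => Im (series (fun i => (a i)%:C / (w - z i)) n)) =
    series (fun i => a i * Im (-1 * (z i - w)^-1)).
  apply/funext => n; rewrite /series/= (big_morph _ (@ImD R) (erefl : Im 0 = 0)).
  by apply: eq_bigr => i _; rewrite mulN1r -invrN opprB ImM /= mul0r addr0.
Qed.

End Mean.

(** * Gram-Schmidt orthogonalization of the resolvents in [L^2(a)] *)

Lemma poly_infinite_roots (F : idomainType) (x : nat -> F) (p : {poly F}) :
  injective x -> (forall i, root p (x i)) -> p = 0.
Proof.
move=> x_inj px; apply/eqP; apply: contraT => p0.
have := @max_poly_roots _ p (map x (iota 0 (size p))) p0.
rewrite size_map size_iota ltnn map_inj_uniq// iota_uniq; apply=> //.
by apply/allP => _ /mapP[i _ ->].
Qed.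

Section GramSchmidt.
Variables (R : realType) (a : nat -> R).
Hypothesis a_gt0 : forall i, 0 < a i.
Hypothesis a_sum1 : series a @ \oo --> (1 : R).
Variable z : nat -> R[i].
Hypothesis z_inj : injective z.
Implicit Types (g h k : nat -> R[i]) (s : seq R[i]).

Definition ip g h := mean a (fun i => g i * conjc (h i)).

Lemma ip_lin c g h k : bounded_seq g -> bounded_seq h -> bounded_seq k ->
  ip (fun i => c * g i + h i) k = c * ip g k + ip h k.
Proof.
move=> bg bh bk; rewrite /ip -mean_lin//; last 2 first.
- by apply: boundedM => //; exact: boundedJ.
- by apply: boundedM => //; exact: boundedJ.
by congr mean; apply/funext => i; rewrite mulrDl mulrA.
Qed.

Lemma ip_sum (c : R[i] -> R[i]) (F : R[i] -> nat -> R[i]) s k :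
  (forall v, v \in s -> bounded_seq (F v)) -> bounded_seq k ->
  ip (fun i => \sum_(v <- s) c v * F v i) k = \sum_(v <- s) c v * ip (F v) k.
Proof.
move=> bF bk; rewrite /ip -mean_sum//; last first.
  by move=> v /bF bv; apply: boundedM => //; exact: boundedJ.
congr mean; apply/funext => i; rewrite mulr_suml.
by apply: eq_bigr => v _; rewrite mulrA.
Qed.

Lemma ipC g h : bounded_seq g -> bounded_seq h -> ip h g = conjc (ip g h).
Proof.
move=> bg bh; rewrite /ip -meanJ//; last first.
  by apply: boundedM => //; exact: boundedJ.
by congr mean; apply/funext => i; rewrite rmorphM/= conjcK mulrC.
Qed.

Lemma ip_cst d g : bounded_seq g -> ip (fun=> d) g = d * conjc (mean a g).
Proof.
by move=> bg; rewrite /ip meanZ// ?meanJ//; exact: boundedJ.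
Qed.

Lemma ip_gt0 g i0 : bounded_seq g -> g i0 != 0 -> 0 < ip g g.
Proof.
move=> bg gi0; apply: (@mean_gt0 _ _ _ _ _ i0) => //.
- by apply: boundedM => //; exact: boundedJ.
- by move=> i; exact: mulcJ_ge0.
- by rewrite mulf_neq0 ?conjc_eq0.
Qed.

(* In [L^2(a)] the resolvents [1 / (z - w)] are, for [w] a zero of [f],
   eigenvectors of the compression of multiplication by [z] to the orthogonal
   complement of the constants. The functions [u] span an invariant subspace
   ([orth_stable]) and have the zeros as Rayleigh quotients ([orth_rayleigh]);
   [orth_rational] serves to show that the resolvent of a further zero is not
   in their span, as a nonzero polynomial cannot vanish at all the [z i]. *)
Record orth_family s (u : R[i] -> nat -> R[i]) : Prop := OrthFamily {
  orth_bounded : forall w, w \in s -> bounded_seq (u w) ;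
  orth_mean : forall w, w \in s -> mean a (u w) = 0 ;
  orth_gt0 : forall w, w \in s -> 0 < ip (u w) (u w) ;
  orth_ip : forall v w, v \in s -> w \in s -> v != w -> ip (u v) (u w) = 0 ;
  orth_stable : forall w, w \in s -> exists (c : R[i] -> R[i]) d, forall i,
    z i * u w i = \sum_(v <- s) c v * u v i + d ;
  orth_rayleigh : forall w, w \in s ->
    ip (fun i => z i * u w i) (u w) = w * ip (u w) (u w) ;
  orth_rational : forall w, w \in s -> exists p : {poly R[i]}, forall i,
    u w i * \prod_(v <- s) (z i - v) = p.[z i] }.

(** One Gram-Schmidt step: the new function [e] is the resolvent [g] of [w0] minus its projection
    [P] onto the span of the earlier functions. *)
Lemma orth_family_cons w0 s u :
  uniq (w0 :: s) -> (forall i, w0 != z i) ->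
  bounded_seq (fun i => (z i - w0)^-1) ->
  mean a (fun i => (z i - w0)^-1) = 0 ->
  orth_family s u -> exists u', orth_family (w0 :: s) u'.
Proof.
move=> /= /andP[w0s us] w0z; pose g i := (z i - w0)^-1.
rewrite -/g => bg mg [bu mu pu ou su ru qu].
pose c v := ip g (u v) / ip (u v) (u v).
pose P i := \sum_(v <- s) c v * u v i.
pose e i := -1 * P i + g i.
have bcu v (k : R[i]) : v \in s -> bounded_seq (fun i => k * u v i).
  by move=> vs; apply: boundedM; [exact: bounded_cst|exact: bu].
have bsum (k : R[i] -> R[i]) : bounded_seq (fun i => \sum_(v <- s) k v * u v i).
  by apply: (@bounded_sum _ _ s (fun v i => k v * u v i)) => v /bcu.
have bP : bounded_seq P by exact: bsum.
have be : bounded_seq e.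
  by apply: boundedD => //; apply: boundedM => //; exact: bounded_cst.
have me : mean a e = 0.
  rewrite mean_lin// mg mean_sum// big_seq big1 ?mulr0 ?addr0// => v vs.
  by rewrite mu// mulr0.
have oe v : v \in s -> ip e (u v) = 0.
  move=> vs; rewrite ip_lin ?ip_sum//; [|exact: bu..].
  rewrite (bigD1_seq v)//= big_seq_cond big1 => [|t /andP[ts tv]].
    by rewrite addr0 /c divfK ?mulN1r ?addNr// gt_eqF// pu.
  by rewrite ou// mulr0.
have eo v : v \in s -> ip (u v) e = 0.
  by move=> vs; rewrite (ipC be (bu _ vs)) oe// conjc0.
have gE i : z i * g i = 1 + w0 * g i.
  have z0 : z i - w0 != 0 by rewrite subr_eq0 eq_sym.
  by apply/eqP; rewrite -subr_eq -mulrBl divff.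
(* Fixes the stability coefficients for all [w] at once; the zero values outside [s] are
   placeholders. *)
have {su} /choice[C suC] : forall w, exists C : (R[i] -> R[i]) * R[i],
    w \in s -> forall i, z i * u w i = \sum_(v <- s) C.1 v * u v i + C.2.
  move=> w; case: (boolP (w \in s)) => [/su[k [d kd]]|_]; first by exists (k, d).
  by exists (fun=> 0, 0).
have {qu} /choice[p pE] : forall w, exists p : {poly R[i]}, w \in s ->
    forall i, u w i * \prod_(v <- s) (z i - v) = p.[z i].
  move=> w; case: (boolP (w \in s)) => [/qu[q qE]|_]; first by exists q.
  by exists 0.
(* The coefficients left over in [z e - w0 e]: substitute [gE] for [z g], and expand [z P] by
   stability of the old span modulo constants. *)
pose k (v : R[i]) := w0 * c v - \sum_(t <- s) c t * (C t).1 v.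
pose d := 1 - \sum_(t <- s) c t * (C t).2.
have eE i : z i * e i = w0 * e i + (\sum_(v <- s) k v * u v i + d).
  have zP : z i * P i = \sum_(v <- s) (\sum_(t <- s) c t * (C t).1 v) * u v i +
      \sum_(t <- s) c t * (C t).2.
    rewrite /P mulr_sumr.
    under [X in _ = X + _]eq_bigr do rewrite mulr_suml.
    rewrite exchange_big -big_split/=; apply: eq_big_seq => t ts.
    rewrite mulrCA suC// mulrDr mulr_sumr; congr (_ + _).
    by apply: eq_bigr => v _; rewrite mulrA.
  have -> : \sum_(v <- s) k v * u v i = w0 * P i -
      \sum_(v <- s) (\sum_(t <- s) c t * (C t).1 v) * u v i.
    rewrite /P mulr_sumr -sumrB; apply: eq_bigr => v _.
    by rewrite /k mulrBl mulrA.
  by rewrite /e mulrDr mulrCA zP gE /d; ring.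
(* The numerator of [e] over the common denominator: the first term comes from [g], the second from
   [P]. *)
pose q := \prod_(v <- s) ('X - v%:P) -
          ('X - w0%:P) * \sum_(v <- s) c v *: p v.
have qE i : e i * ((z i - w0) * \prod_(v <- s) (z i - v)) = q.[z i].
  have z0 : z i - w0 != 0 by rewrite subr_eq0 eq_sym.
  rewrite /q hornerD hornerN hornerM horner_prod hornerXsubC horner_sum.
  under [X in _ = X - _]eq_bigr do rewrite hornerXsubC.
  have -> : \sum_(v <- s) (c v *: p v).[z i] = P i * \prod_(v <- s) (z i - v).
    rewrite /P mulr_suml; apply: eq_big_seq => v vs.
    by rewrite hornerZ -pE// mulrA.
  have gz : g i * (z i - w0) = 1 by rewrite mulVf.
  by rewrite /e mulrDl [g i * _]mulrA gz; ring.
(* If [e] vanished everywhere, [q] would have all the distinct [z i] as roots and be zero, but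
   [q.[w0]] is a product of nonzero factors [w0 - v]. *)
have [i0 ei0] : exists i, e i != 0.
  apply: contrapT => /forallNP e0.
  have q0 : q = 0.
    apply: (@poly_infinite_roots _ z) => // i; rewrite rootE -qE.
    by have /negP/negPn/eqP -> := e0 i; rewrite mul0r.
  have : q.[w0] != 0.
    rewrite /q hornerD hornerN hornerM hornerXsubC subrr mul0r subr0.
    rewrite horner_prod prodf_seq_neq0; apply/allP => v vs /=.
    by rewrite hornerXsubC subr_eq0; apply: contraNneq w0s => ->.
  by rewrite q0 horner0 eqxx.
have pe : 0 < ip e e by apply: ip_gt0 ei0.
(* In [eE], the part outside [w0 * e] lies in the span of the [u v] and the constants, to which [e]
   is orthogonal. *)
have re : ip (fun i => z i * e i) e = w0 * ip e e.
  have -> : (fun i => z i * e i) = fun i => w0 * e i +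
      (1 * (\sum_(v <- s) k v * u v i) + d).
    by apply/funext => i; rewrite mul1r eE.
  rewrite ip_lin ?ip_sum//; last first.
    apply: boundedD; [apply: boundedM => //|]; exact: bounded_cst.
  rewrite ip_lin ?ip_sum ?ip_cst ?me ?conjc0//; last first.
    exact: bounded_cst.
  rewrite big_seq big1 => [|v vs]; last by rewrite eo// mulr0.
  by rewrite !mulr0 !addr0.
pose u' v := if v == w0 then e else u v.
have u0E : u' w0 = e by rewrite /u' eqxx.
have usE v : v \in s -> u' v = u v.
  by move=> vs; rewrite /u'; case: eqVneq => // vw; rewrite -vw vs in w0s.
exists u'; split.
- by move=> w; rewrite inE => /predU1P[->|ws]; rewrite ?u0E// usE//; exact: bu.
- by move=> w; rewrite inE => /predU1P[->|ws]; rewrite ?u0E// usE//; exact: mu.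
- by move=> w; rewrite inE => /predU1P[->|ws]; rewrite ?u0E// usE//; exact: pu.
- move=> v w; rewrite !inE => /predU1P[->|vs] /predU1P[->|ws].
  + by rewrite eqxx.
  + by rewrite u0E usE// oe.
  + by rewrite u0E usE// eo.
  + by rewrite !usE//; exact: ou.
- have sumE (b : R[i] -> R[i]) i : \sum_(v <- w0 :: s) b v * u' v i =
      b w0 * e i + \sum_(v <- s) b v * u v i.
    rewrite big_cons u0E; congr (_ + _); apply: eq_big_seq => v vs.
    by rewrite usE.
  move=> w; rewrite inE => /predU1P[->|ws].
    exists (fun v => if v == w0 then w0 else k v), d => i.
    rewrite u0E sumE eqxx eE addrA; congr (_ + _ + _).
    apply: eq_big_seq => v vs; case: eqVneq => // vw.
    by rewrite -vw vs in w0s.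
  exists (fun v => if v == w0 then 0 else (C w).1 v), (C w).2 => i.
  rewrite usE// sumE eqxx mul0r add0r suC//; congr (_ + _).
  apply: eq_big_seq => v vs; case: eqVneq => // vw.
  by rewrite -vw vs in w0s.
- by move=> w; rewrite inE => /predU1P[->|ws]; rewrite ?u0E// usE//; exact: ru.
- move=> w; rewrite inE => /predU1P[->|ws].
    by exists q => i; rewrite u0E big_cons qE.
  exists (('X - w0%:P) * p w) => i.
  by rewrite usE// big_cons hornerM hornerXsubC -pE// mulrCA.
Qed.

Lemma exists_orth_family s : uniq s ->
  (forall w, w \in s -> [/\ forall i, w != z i,
    bounded_seq (fun i => (z i - w)^-1) &
    mean a (fun i => (z i - w)^-1) = 0]) ->
  exists u, orth_family s u.
Proof.
elim: s => [|w s ih] us ws; first by exists (fun _ _ => 0).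
have [||u ou] := ih.
- by case/andP: us.
- by move=> v vs; apply: ws; rewrite inE vs orbT.
have [wz bw mw] := ws w (mem_head _ _).
exact: orth_family_cons ou.
Qed.

(* Bessel's inequality for the indicator of [{i}] and the family formed by [u]
   and the constant [1], divided by [a i]. *)
Lemma orth_bessel s u i : uniq s -> orth_family s u ->
  \sum_(w <- s) (a i)%:C * `|u w i| ^+ 2 / ip (u w) (u w) <= (1 - a i)%:C.
Proof.
move=> us [bu mu pu ou _ _ _].
(* Minus the Fourier coefficient of the indicator [dl] along [u w]; [a i] below is its coefficient
   along the constant 1. Hence [H] is the residual of [dl] after projection. *)
pose c w := - ((a i)%:C * conjc (u w i) / ip (u w) (u w)).
pose dl j := if j == i then (1 : R[i]) else 0.
pose h j := -1 * (a i)%:C + dl j.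
pose H j := 1 * (\sum_(w <- s) c w * u w j) + h j.
have bd : bounded_seq dl.
  by exists 1 => j; rewrite /dl; case: ifP; rewrite ?normr1 ?normr0.
have bh : bounded_seq h by apply: boundedD => //; exact: bounded_cst.
have bs : bounded_seq (fun j => \sum_(w <- s) c w * u w j).
  apply: (@bounded_sum _ _ s (fun w j => c w * u w j)) => w /bu bw.
  by apply: boundedM => //; exact: bounded_cst.
have bH : bounded_seq H.
  by apply: boundedD => //; apply: boundedM => //; exact: bounded_cst.
have dlE g : bounded_seq g -> ip dl g = (a i)%:C * conjc (g i).
  move=> bg; rewrite /ip -(mean_point a i).
  congr mean; apply/funext => j; rewrite /dl.
  by case: eqVneq => [->|_]; rewrite ?mul1r ?mul0r.
have b1 : bounded_seq (fun=> (a i)%:C) by exact: bounded_cst.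
have uH w : w \in s -> ip H (u w) = 0.
  move=> ws; have bw := bu _ ws.
  rewrite ip_lin ?ip_sum// /h ip_lin ?ip_cst// mu// conjc0 !mulr0 add0r mul1r.
  rewrite dlE// (bigD1_seq w)//= big_seq_cond big1 => [|t /andP[ts tw]].
    by rewrite addr0 /c mulNr divfK ?addNr// gt_eqF// pu.
  by rewrite ou// mulr0.
have mdl : mean a dl = (a i)%:C by rewrite mean_point mulr1.
have mH : mean a H = 0.
  rewrite mean_lin// mean_sum// big_seq big1 => [|w ws]; last by rewrite mu ?mulr0.
  by rewrite mulr0 add0r mean_lin// mean_cst// mdl mulN1r addNr.
(* The residual [H] is orthogonal to all that was subtracted, so its squared norm is its product
   with [dl]. Thus [H i >= 0], and [H i] is the right side of the claim minus the left. *)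
have HH : ip H H = (a i)%:C * conjc (H i).
  rewrite [LHS]ip_lin// ip_sum// big_seq big1 => [|w ws]; last first.
    by rewrite (ipC bH (bu _ ws)) uH// conjc0 mulr0.
  by rewrite mulr0 add0r /h ip_lin// ip_cst// mH conjc0 !mulr0 add0r dlE.
have : 0 <= ip H H.
  apply: mean_ge0 => //; first by apply: boundedM => //; exact: boundedJ.
  by move=> j; exact: mulcJ_ge0.
rewrite HH pmulr_rge0 ?ltcR// conj_ge0 /H /h /dl eqxx mul1r => Hi.
rewrite -subr_ge0; apply: le_trans Hi _.
rewrite rmorphB/= rmorph1 mulN1r [X in _ <= X]addrC [- _ + 1]addrC lerD2r.
rewrite -sumrN ler_sum// => w _.
rewrite /c mulNr lerN2 sqr_normc le_eqVlt; apply/orP; left; apply/eqP.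
by rewrite [RHS]mulrAC; congr (_ / _); ring.
Qed.

End GramSchmidt.

(** * Jensen's inequality for nonnegative convex functions on the plane *)

Section Jensen.
Variable R : realType.

Definition convex_on_plane (psi : R[i] -> R) := forall (x y : R[i]) (t r : R),
  0 <= t -> 0 <= r -> t + r = 1 ->
  psi (t%:C * x + r%:C * y) <= t * psi x + r * psi y.

Lemma convex_function_plane (Phi : R[i] -> R) :
  convex_function [set: Rcomplex R] Phi -> convex_on_plane Phi.
Proof.
move=> cPhi x y t r t0 r0 tr.
have t1 : t <= 1 by rewrite -tr lerDl.
have := cPhi (Itv01 t0 t1) x y; rewrite !inE => /(_ I I).
have rE : r = 1 - t by rewrite -tr addrC addKr.
rewrite rE; congr (_ <= _); congr Phi.
by apply: complex_eq; case: x => x1 x2; case: y => y1 y2 /=;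
  rewrite !mul0r ?subr0 ?addr0.
Qed.

Lemma convex_on_plane_affine (psi : R[i] -> R) lambda mu :
  convex_on_plane psi -> convex_on_plane (fun x => psi (lambda * x + mu)).
Proof.
move=> cpsi x y t r t0 r0 tr; apply: le_trans (cpsi _ _ _ _ t0 r0 tr).
rewrite le_eqVlt; apply/orP; left; apply/eqP; congr psi.
rewrite -[X in _ + X = _]mul1r -[X in X * mu](rmorph1 (real_complex R)) -tr.
by rewrite rmorphD/=; ring.
Qed.

Variable psi : R[i] -> R.
Hypothesis psi_convex : convex_on_plane psi.
Hypothesis psi_ge0 : forall x, 0 <= psi x.

(** A point of the square is a convex combination of the four corners, first horizontally and then
    vertically. Weights are at most 1 and [psi] is nonnegative, so the sum of the corner values is a
    bound. *)
Lemma convex_square_bounded (B : R) : 0 < B -> exists M : R, forall x : R[i],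
  `|Re x| <= B -> `|Im x| <= B -> psi x <= M.
Proof.
move=> B0.
have seg (x y : R[i]) t : `|t| <= B ->
    psi (((B + t) / (B *+ 2))%:C * x + ((B - t) / (B *+ 2))%:C * y)
    <= psi x + psi y.
  rewrite ler_norml => /andP[tl tu].
  have B2 : 0 < B *+ 2 by rewrite mulrn_wgt0.
  have l0 : 0 <= (B + t) / (B *+ 2).
    by apply: divr_ge0; [rewrite -lerBlDl sub0r|exact: ltW].
  have r0 : 0 <= (B - t) / (B *+ 2).
    by apply: divr_ge0; [rewrite subr_ge0|exact: ltW].
  have lr : (B + t) / (B *+ 2) + (B - t) / (B *+ 2) = 1.
    by rewrite -mulrDl addrACA subrr addr0 -mulr2n divff// gt_eqF.
  apply: le_trans (psi_convex x y l0 r0 lr) _.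
  by apply: lerD; apply: ler_piMl => //; rewrite -lr ?lerDl ?lerDr.
have half (t : R) : (B + t) / (B *+ 2) * B + (B - t) / (B *+ 2) * (- B) = t.
  by field; rewrite gt_eqF.
have one (t c : R) : (B + t) / (B *+ 2) * c + (B - t) / (B *+ 2) * c = c.
  by field; rewrite gt_eqF.
exists ((psi (B +i* B) + psi (B -i* B)) + (psi ((- B) +i* B) + psi (- B -i* B))).
move=> x xre xim.
have hx : x = ((B + Re x) / (B *+ 2))%:C * (B +i* Im x) +
              ((B - Re x) / (B *+ 2))%:C * (- B +i* Im x).
  by apply: complex_eq;
    rewrite ?ReD ?ImD ?ReM ?ImM /= !mul0r ?subr0 ?addr0 ?half ?one.
have vx c : c +i* Im x = ((B + Im x) / (B *+ 2))%:C * (c +i* B) +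
              ((B - Im x) / (B *+ 2))%:C * (c -i* B).
  by apply: complex_eq;
    rewrite ?ReD ?ImD ?ReM ?ImM /= !mul0r ?subr0 ?addr0 ?half ?one.
rewrite [in leLHS]hx; apply: le_trans (seg _ _ _ xre) _.
by apply: lerD; rewrite vx; exact: seg.
Qed.

(** The extra mass [r] at [y] later carries the tail of an infinite combination. The induction
    merges the last point with [y] into their barycentre. *)
Lemma jensen_finite (p : nat -> R) (x : nat -> R[i]) n (r : R) (y : R[i]) :
  (forall i, 0 <= p i) -> 0 <= r -> \sum_(0 <= i < n) p i + r = 1 ->
  psi (\sum_(0 <= i < n) (p i)%:C * x i + r%:C * y) <=
  \sum_(0 <= i < n) p i * psi (x i) + r * psi y.
Proof.
move=> p0; elim: n r y => [|n ih] r y r0.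
  by rewrite !big_nil !add0r => ->; rewrite mul1r rmorph1 mul1r.
rewrite !big_nat_recr//= -!addrA => sum1.
have pr0 : 0 <= p n + r by rewrite addr_ge0.
(* With no mass left the barycentre [y'] is undefined; both terms vanish and the induction
   hypothesis applies with zero extra mass. *)
have [pr|pr] := eqVneq (p n + r) 0.
  have [pn rn] : p n = 0 /\ r = 0.
    by move/eqP: pr; rewrite paddr_eq0// => /andP[/eqP-> /eqP->].
  have := ih 0 0 (lexx _).
  by rewrite -[X in _ = X]sum1 pr pn rn rmorph0 !mul0r !addr0; exact.
pose y' := (p n / (p n + r))%:C * x n + (r / (p n + r))%:C * y.
have yE : (p n)%:C * x n + r%:C * y = (p n + r)%:C * y'.
  rewrite /y' mulrDr !mulrA -!rmorphM/=.
  by rewrite ![(p n + r) * _]mulrC !divfK.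
rewrite yE; apply: le_trans (ih _ y' pr0 sum1) _; rewrite lerD2l.
have -> : p n * psi (x n) + r * psi y = (p n + r) *
    (p n / (p n + r) * psi (x n) + r / (p n + r) * psi y) by field.
rewrite ler_wpM2l//; apply: psi_convex; rewrite ?divr_ge0//.
by rewrite -mulrDl divff.
Qed.

(** The partial sums of the nonnegative terms [p i * (B - f i)] increase to [B - l]. *)
Lemma weighted_tail_le (p f : nat -> R) (B l : R) n :
  (forall i, 0 <= p i) -> series p @ \oo --> (1 : R) ->
  (forall i, f i <= B) -> series (fun i => p i * f i) @ \oo --> l ->
  l - series (fun i => p i * f i) n <= B * (1 - series p n).
Proof.
move=> p0 p1 fB fl.
pose g i := p i * (B - f i).
have gE m : series g m = B * series p m - series (fun i => p i * f i) m.
  rewrite /series/= mulr_sumr -sumrB; apply: eq_bigr => i _.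
  by rewrite /g mulrBr [B * _]mulrC.
have gc : series g @ \oo --> B * 1 - l.
  have -> : series g = fun m => B * series p m - series (fun i => p i * f i) m.
    by apply/funext => m; rewrite gE.
  by apply: cvgB => //; exact: cvgMl_tmp.
have : series g n <= limn (series g).
  apply: nondecreasing_cvgn_le; last by apply/cvg_ex; exists (B * 1 - l).
  apply: nondecreasing_series => i _ _.
  by rewrite /g mulr_ge0// subr_ge0.
rewrite (cvg_lim (@Rhausdorff R) gc) gE; lra.
Qed.

Lemma weighted_tail_norm (p f : nat -> R) (B l : R) n :
  (forall i, 0 <= p i) -> series p @ \oo --> (1 : R) ->
  (forall i, `|f i| <= B) -> series (fun i => p i * f i) @ \oo --> l ->
  `|l - series (fun i => p i * f i) n| <= B * (1 - series p n).
Proof.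
move=> p0 p1 fB fl; rewrite ler_norml; apply/andP; split; last first.
  by apply: weighted_tail_le => // i; exact: le_trans (ler_norm _) (fB i).
have NE : series (fun i => p i * - f i) = - series (fun i => p i * f i).
  rewrite -seriesN; congr series; apply/funext => i.
  by rewrite !fctE mulrN.
have : - l - series (fun i => p i * - f i) n <= B * (1 - series p n).
  apply: weighted_tail_le => //.
    by move=> i; rewrite (le_trans _ (fB i))// -normrN ler_norm.
  by rewrite NE; exact: cvgN.
by rewrite NE !fctE opprK; lra.
Qed.

(** The tail of mass [r] is concentrated at its barycentre [y]. The tail estimates keep [y] in the
    square, where [psi] is at most [M]; no continuity of [psi] is invoked. *)
Lemma jensen_series (p : nat -> R) (x : nat -> R[i]) (w : R[i]) (B M : R) n :
  (forall i, 0 <= p i) -> series p @ \oo --> (1 : R) ->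
  (forall i, `|Re (x i)| <= B) -> (forall i, `|Im (x i)| <= B) ->
  series (fun i => p i * Re (x i)) @ \oo --> Re w ->
  series (fun i => p i * Im (x i)) @ \oo --> Im w ->
  (forall y, `|Re y| <= B -> `|Im y| <= B -> psi y <= M) ->
  psi w <= \sum_(0 <= i < n) p i * psi (x i) + (1 - series p n) * M.
Proof.
move=> p0 p1 xre xim wre wim psiM.
have B0 : 0 <= B by exact: le_trans (xre 0%N).
pose r := 1 - series p n; pose q := w - \sum_(0 <= i < n) (p i)%:C * x i.
have qre : `|Re q| <= B * r.
  have -> : Re q = Re w - series (fun i => p i * Re (x i)) n.
    rewrite /q ReD; congr (_ + _); rewrite -mulN1r ReM/= oppr0 mul0r subr0 mulN1r.
    congr (- _); rewrite (big_morph _ (@ReD R) (erefl : Re 0 = 0)).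
    by apply: eq_bigr => i _; rewrite ReM/= mul0r subr0.
  exact: weighted_tail_norm.
have qim : `|Im q| <= B * r.
  have -> : Im q = Im w - series (fun i => p i * Im (x i)) n.
    rewrite /q ImD; congr (_ + _); rewrite -mulN1r ImM/= oppr0 mul0r addr0 mulN1r.
    congr (- _); rewrite (big_morph _ (@ImD R) (erefl : Im 0 = 0)).
    by apply: eq_bigr => i _; rewrite ImM/= mul0r addr0.
  exact: weighted_tail_norm.
have r0 : 0 <= r.
  have : series p n <= limn (series p).
    apply: nondecreasing_cvgn_le; last by apply/cvg_ex; exists 1.
    by apply: nondecreasing_series => i _ _.
  by rewrite (cvg_lim (@Rhausdorff R) p1) subr_ge0.
pose y := (r^-1)%:C * q.
(* When [r = 0] the inverse is 0 and so is [y]; the bounds [B * r] then force [q = 0]. *)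
have yq : r%:C * y = q.
  have [rz|rn] := eqVneq r 0; last by rewrite /y mulrA -rmorphM/= divff// mul1r.
  rewrite rz mul0r; apply: complex_eq; symmetry; apply/eqP;
    by rewrite -normr_le0 -[leRHS](mulr0 B) -rz.
have rB : r^-1 * (B * r) <= B.
  have [->|rn] := eqVneq r 0; first by rewrite invr0 mul0r.
  by rewrite mulrC mulfK.
have -> : w = \sum_(0 <= i < n) (p i)%:C * x i + r%:C * y.
  by rewrite yq /q addrC subrK.
apply: le_trans (jensen_finite _ _ p0 r0 _) _.
  by rewrite /r /series/= addrC subrK.
rewrite lerD2l ler_wpM2l// psiM//; apply: le_trans rB.
- rewrite /y ReM/= mul0r subr0 normrM ger0_norm ?invr_ge0//.
  by rewrite ler_wpM2l ?invr_ge0.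
- rewrite /y ImM/= mul0r addr0 normrM ger0_norm ?invr_ge0//.
  by rewrite ler_wpM2l ?invr_ge0.
Qed.

End Jensen.

(** * Probability weights representing the zeros, and the inequality for finitely many zeros *)

Section ZeroSums.
Variables (R : realType) (a : nat -> R).
Hypothesis a_gt0 : forall i, 0 < a i.
Hypothesis a_sum1 : series a @ \oo --> (1 : R).
Variable z : nat -> R[i].
Hypothesis z_bounded : bounded_seq z.

(** The weights are the normalized densities [a i * |u w i|^2]: the Rayleigh quotients give the
    barycentres [w], and [orth_bessel] gives the bound on the sum over [w]. *)
Lemma orth_family_weights (s : seq R[i]) u : uniq s -> orth_family a z s u ->
  exists p : R[i] -> nat -> R,
    (forall w i, w \in s -> 0 <= p w i) /\
    (forall w, w \in s -> [/\ series (p w) @ \oo --> (1 : R),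
       series (fun i => p w i * Re (z i)) @ \oo --> Re w &
       series (fun i => p w i * Im (z i)) @ \oo --> Im w]) /\
    (forall i, \sum_(w <- s) p w i <= 1 - a i).
Proof.
move=> us ou; pose N w := Re (ip a (u w) (u w)).
pose q w i := Re (u w i * conjc (u w i)).
have NE w : w \in s -> ip a (u w) (u w) = (N w)%:C.
  by move=> /(orth_gt0 ou) /ltW; rewrite lecE => /andP[/eqP h _];
    apply: complex_eq.
have N0 w : w \in s -> 0 < N w.
  by move=> ws; have := orth_gt0 ou ws; rewrite NE// ltcR.
have qE w i : u w i * conjc (u w i) = (q w i)%:C.
  by have := mulcJ_ge0 (u w i); rewrite lecE => /andP[/eqP h _];
    apply: complex_eq.
have q0 w i : 0 <= q w i by rewrite -ler0c -qE mulcJ_ge0.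
exists (fun w i => a i * q w i / N w); split; last split.
- move=> w i ws; apply: divr_ge0; last exact: ltW (N0 _ ws).
  by rewrite mulr_ge0// ltW.
- move=> w ws; have bw := orth_bounded ou ws.
  have bq : bounded_seq (fun i => u w i * conjc (u w i)).
    by apply: boundedM => //; exact: boundedJ.
  have divN (f g : nat -> R) l : series g @ \oo --> l * N w ->
      (forall i, f i = g i / N w) -> series f @ \oo --> l.
    move=> gl fg; rewrite -(mulfK (lt0r_neq0 (N0 _ ws)) l).
    have -> : series f = fun n => series g n / N w.
      by apply/funext => n; rewrite /series/= mulr_suml; apply: eq_bigr.
    exact: cvgMr_tmp.
  have [q1 _] := mean_cvg a_gt0 a_sum1 bq.
  have [m1 m2] := mean_cvg a_gt0 a_sum1 (boundedM z_bounded bq).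
  have mE : mean a (fun i => z i * (u w i * conjc (u w i))) = w * (N w)%:C.
    rewrite -NE// -(orth_rayleigh ou ws) /ip; congr mean.
    by apply/funext => i; rewrite mulrA.
  split.
  + by apply: divN; [rewrite mul1r; exact: q1|].
  + apply: (divN _ (fun i => a i * Re (z i * (u w i * conjc (u w i))))) => [|i].
      by move: m1; rewrite mE ReM/= mulr0 subr0; exact.
    by rewrite qE ReM/= mulr0 subr0; ring.
  + apply: (divN _ (fun i => a i * Im (z i * (u w i * conjc (u w i))))) => [|i].
      by move: m2; rewrite mE ImM/= mulr0 add0r; exact.
    by rewrite qE ImM/= mulr0 add0r; ring.
- move=> i; have := orth_bessel a_gt0 a_sum1 i us ou.
  rewrite -lecR rmorph_sum/=; congr (_ <= _); apply: eq_big_seq => w ws.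
  by rewrite NE// sqr_normc qE -fmorphV -!rmorphM.
Qed.

Hypothesis z_inj : injective z.

(** Apply [jensen_series] truncated at [n] to each zero, add up, and let [n] tend to infinity: only
    finitely many error terms occur, each proportional to a vanishing tail mass. *)
Lemma sum_zeros_le (psi : R[i] -> R) (s : seq R[i]) b :
  convex_on_plane psi -> (forall x, 0 <= psi x) -> uniq s ->
  (forall w, w \in s -> [/\ forall i, w != z i,
    bounded_seq (fun i => (z i - w)^-1) &
    mean a (fun i => (z i - w)^-1) = 0]) ->
  (forall n, \sum_(0 <= i < n) (1 - a i) * psi (z i) <= b) ->
  \sum_(w <- s) psi w <= b.
Proof.
move=> cpsi psi0 us ws bn.
have [u ou] := exists_orth_family a_gt0 a_sum1 z_inj us ws.
have [p [p0 [pc pa]]] := orth_family_weights us ou.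
have [B B0 [zre zim]] : exists2 B : R, 0 < B &
    (forall i, `|Re (z i)| <= B) /\ (forall i, `|Im (z i)| <= B).
  have [M zM] := z_bounded.
  have zre i : `|Re (z i)| <= Re M := ler_Re (le_trans (normc_ge_Re _) (zM i)).
  have zim i : `|Im (z i)| <= Re M := ler_Re (le_trans (normc_ge_Im _) (zM i)).
  (* Adding 1 makes the half-side strictly positive, as [convex_square_bounded] requires. *)
  exists (Re M + 1); first by rewrite ltr_wpDl// (le_trans _ (zre 0%N)).
  by split=> i; rewrite ler_wpDr.
have [M psiM] := convex_square_bounded cpsi psi0 B0.
have le_n n : \sum_(w <- s) psi w <= b + \sum_(w <- s) (1 - series (p w) n) * M.
  apply: (@le_trans _ _ (\sum_(w <- s) (\sum_(0 <= i < n) p w i * psi (z i) +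
      (1 - series (p w) n) * M))).
    rewrite big_seq [leRHS]big_seq; apply: ler_sum => w ins.
    have [p1 pre pim] := pc w ins.
    by apply: (jensen_series cpsi n _ p1 zre zim pre pim psiM) => i; exact: p0.
  (* After exchanging the sums, the coefficient of [psi (z i)] is the total weight at [i], at most
     [1 - a i]. *)
  rewrite big_split/= lerD2r exchange_big/=; apply: le_trans (bn n).
  by apply: ler_sum => i _; rewrite -mulr_suml ler_wpM2r.
have : (\sum_(w <- s | w \in s) (1 - series (p w) n) * M) @[n --> \oo] -->
    \sum_(w <- s | w \in s) (0 : R).
  apply: (@cvg_big R R[i] +%R 0 (mem s)) => [|w ins].
    exact: add_continuous.
  rewrite -(mul0r M) -(subrr 1); apply: cvgMr_tmp.
  by apply: cvgB; [exact: cvg_cst|have [] := pc w ins].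
rewrite [X in _ --> X]big1//; under eq_fun do rewrite -big_seq.
move=> tail0.
have cv : (b + \sum_(w <- s) (1 - series (p w) n) * M) @[n --> \oo] --> b + 0.
  by apply: cvgD => //; exact: cvg_cst.
rewrite -(addr0 b); apply: (ler_cvg_to (cvg_cst _) cv).
by near=> n; exact: le_n.
Unshelve. all: by end_near. Qed.

End ZeroSums.

Theorem theorem7 (R : realType) (rho : R) (rho_gt0 : 0 < rho)
    (a : nat -> R) (a_gt0 : forall i, 0 < a i)
    (a_sum1 : series a @ \oo --> (1 : R))
    (z : nat -> R[i]) (z_inj : injective z)
    (z_disk : forall i, `|z i| < rho%:C)
    (z_lim : (z : nat -> R[i]^o) @ \oo --> (rho%:C : R[i]^o))
    (zeros_neq0 : disk_zeros rho a z !=set0)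
    (lambda mu : R[i]) (lambda_neq0 : lambda != 0)
    (Phi : R[i] -> R) (Phi_ge0 : forall u, 0 <= Phi u)
    (Phi_convex : convex_function [set: Rcomplex R] Phi) :
  (\esum_(w in disk_zeros rho a z) (Phi (lambda * w + mu))%:E
   <= \sum_(0 <= i <oo) ((1 - a i) * Phi (lambda * z i + mu))%:E)%E.
Proof.
have z_bounded : bounded_seq z by exists rho%:C => i; exact: ltW.
have a_le1 i : a i <= 1.
  have : series a i.+1 <= limn (series a).
    apply: nondecreasing_cvgn_le; last by apply/cvg_ex; exists 1.
    by apply: nondecreasing_series => j _ _; exact: ltW.
  rewrite (cvg_lim (@Rhausdorff R) a_sum1); apply: le_trans.
  by rewrite seriesSr lerDr sumr_ge0// => j _; exact: ltW.
have term_ge0 i : (0 <= ((1 - a i) * Phi (lambda * z i + mu))%:E)%E.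
  by rewrite lee_fin mulr_ge0// subr_ge0.
(* The left side is a supremum over finite subsets [X] of the zero set, so it suffices to bound each
   finite sum. *)
apply: ge_ereal_sup => _ [X [Xfin Xsub] <-].
case: (finite_seqP X).1 => // s0 Xs0.
pose s := undup s0; have us : uniq s by exact: undup_uniq.
have -> : X = [set` s].
  by rewrite Xs0; apply/seteqP; split => w /=; rewrite mem_undup.
rewrite -fsbig_seq//= sumEFin.
have partial_le n : (((\sum_(0 <= i < n) (1 - a i) * Phi (lambda * z i + mu))%:E)
    <= \sum_(0 <= i <oo) ((1 - a i) * Phi (lambda * z i + mu))%:E)%E.
  by rewrite -sumEFin; apply: nneseries_lim_ge.
(* A finite right side serves as the bound [b]; the value [+oo] is trivial, and [-oo] contradicts
   the empty partial sum. *)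
case: (\sum_(0 <= i <oo) _)%E partial_le => [b||] partial_le.
- rewrite lee_fin.
  apply: (@sum_zeros_le _ a a_gt0 a_sum1 z _ z_inj
    (fun w => Phi (lambda * w + mu))) => //.
  + by apply: convex_on_plane_affine; exact: convex_function_plane.
  + move=> w ws.
    have /Xsub[wrho wz w0] : X w by rewrite Xs0/= -mem_undup.
    have bw := bounded_resolvent z_lim wrho.
    split=> //; apply/eqP; rewrite -oppr_eq0 -pole_series_mean// w0//.
- exact: leey.
- by have := partial_le 0%N.
Qed.
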